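(* Let $G$ be a free group with finitely many free generators $a_1,\ldots,a_N$, and for $g\in G$ let $|g|$ denote the word length of $g$. For any $t>0$, the function \[ K_t(g,h)=\exp\left(-t|h^{-1}g|\right)\quad (g,h\in G) \] is strictly positive definite on $G\times G$.
   Context: The word length $|g|$ is the length of the reduced word in $a_1^{\pm1},\ldots,a_N^{\pm1}$ representing $g$. A function $k:X\times X\to\mathbb{C}$ on a set $X$ is called a kernel if $k(y,x)=\overline{k(x,y)}$ for all $x,y\in X$ and $\sum_{i,j=1}^n c_i\overline{c_j}k(x_i,x_j)\ge 0$ for any $n\ge 1$, any $x_1,\ldots,x_n\in X$ and any $(c_1,\ldots,c_n)\in\mathbb{C}^n$. A kernel $k$ is strictly positive (strictly positive definite) if $\sum_{i,j=1}^n c_i\overline{c_j}k(x_i,x_j)>0$ for any $n\ge1$, any $n$ distinct points $x_1,\ldots,x_n\in X$ and any $(c_1,\ldots,c_n)\in\mathbb{C}^n\setminus\{\mathbf{0}\}$. *)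

(* Defs.v *)
From mathcomp Require Import all_boot all_order all_algebra.
From mathcomp Require Import boolp reals sequences exp.
From mathcomp.real_closed Require Import complex.

Set Implicit Arguments.
Unset Strict Implicit.
Unset Printing Implicit Defensive.

Import Order.TTheory GRing.Theory Num.Theory.
Local Open Scope ring_scope.

(** * Free groups and word length *)

(* The letter (i, false) stands for a_i and (i, true) for a_i^-1. *)
Definition letter (N : nat) : Type := ('I_N * bool)%type.

Definition letter_inv (N : nat) (l : letter N) : letter N := (l.1, ~~ l.2).

Definition reduced (N : nat) (w : seq (letter N)) : bool :=
  sorted (fun l m : letter N => m != letter_inv l) w.

Definition letter_val (G : groupType) (N : nat) (a : 'I_N -> G)
    (l : letter N) : G :=
  if l.2 then ((a l.1)^-1)%g else a l.1.

Definition word_val (G : groupType) (N : nat) (a : 'I_N -> G)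
    (w : seq (letter N)) : G :=
  (\prod_(l <- w) letter_val a l)%g.

(* G is free on the family a: every element is represented by exactly one
   reduced word.  The a_i are then automatically pairwise distinct. *)
Definition free_generators (G : groupType) (N : nat) (a : 'I_N -> G) : Prop :=
  forall g : G, exists! w : seq (letter N), reduced w /\ word_val a w = g.

Definition reduced_word (G : groupType) (N : nat) (a : 'I_N -> G)
    (aF : free_generators a) (g : G) : seq (letter N) :=
  sval (cid (aF g)).

Definition word_length (G : groupType) (N : nat) (a : 'I_N -> G)
    (aF : free_generators a) (g : G) : nat :=
  size (reduced_word aF g).

(** * Positive definite kernels *)

(* The order on R[i] is partial: 0 <= z (resp. 0 < z) means that z is real and
   nonnegative (resp. positive). *)
Definition is_kernel (R : realType) (X : Type) (k : X -> X -> R[i]) : Prop :=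
  (forall x y : X, k y x = (k x y)^*) /\
  (forall (n : nat) (x : 'I_n -> X) (c : 'rV[R[i]]_n), (1 <= n)%N ->
     0 <= \sum_(i < n) \sum_(j < n) c 0 i * (c 0 j)^* * k (x i) (x j)).

Definition strictly_positive_definite (R : realType) (X : Type)
    (k : X -> X -> R[i]) : Prop :=
  is_kernel k /\
  (forall (n : nat) (x : 'I_n -> X) (c : 'rV[R[i]]_n), (1 <= n)%N ->
     injective x -> c != 0 ->
     0 < \sum_(i < n) \sum_(j < n) c 0 i * (c 0 j)^* * k (x i) (x j)).

(* Main.v *)
Require Import Defs.
From mathcomp Require Import all_boot all_order all_algebra.
From mathcomp Require Import boolp reals sequences exp.
From mathcomp.real_closed Require Import complex.

Import Order.TTheory GRing.Theory Num.Theory.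
Local Open Scope ring_scope.

(** Write x_u for the element with reduced word u, and put r := exp(-t).  If p
    is the longest common prefix of u and v, then cancelling p in x_v^-1 x_u
    leaves a reduced word, so the kernel at (x_u, x_v) is
    r^(|u| + |v| - 2|p|).  Telescoping r^(-2|p|) over the prefixes of p turns
    this into a sum over all common prefixes s of u and v of
    r^|u| r^|v| W(|s|) with every W(k) > 0.  The quadratic form of the kernel
    is therefore a sum over words s of W(|s|) |sum_i c_i [s <= u_i] r^|u_i||^2,
    where [s <= u_i] says that s is a prefix of u_i.  If u_i has maximal length
    among the words with c_i <> 0, the term s = u_i is
    W(|u_i|) |c_i|^2 r^(2|u_i|) > 0. *)

Fixpoint lcp {T : eqType} (u v : seq T) : seq T :=
  match u, v with
  | x :: u', y :: v' => if x == y then x :: lcp u' v' else [::]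
  | _, _ => [::]
  end.

Lemma lcpC (T : eqType) (u v : seq T) : lcp u v = lcp v u.
Proof.
elim: u v => [|x u IH] [|y v] //=; rewrite eq_sym IH.
by case: eqP => // ->.
Qed.

Lemma prefix_lcp (T : eqType) (s u v : seq T) :
  prefix s (lcp u v) = prefix s u && prefix s v.
Proof.
elim: s u v => [|z s IH] [|x u] [|y v]; rewrite ?prefix0s //= ?andbF //.
case: (x =P y) => [<-|nxy] /=; first by rewrite IH; case: (z == x).
case: (z =P x) => //= zx; case: (z =P y) => //= zy; last by rewrite andbF.
by case: nxy; rewrite -zx.
Qed.

Lemma lcp_decomp (T : eqType) (u v : seq T) :
  exists u' v', [/\ u = lcp u v ++ u', v = lcp u v ++ v' & lcp u' v' = [::]].
Proof.
elim: u v => [|x u IH] [|y v] /=.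
- by exists [::], [::].
- by exists [::], (y :: v).
- by exists (x :: u), [::].
- case: (x =P y) => [<-|nxy]; last first.
    by exists (x :: u), (y :: v); split=> //=; case: eqP.
  have [u' [v' [eu ev e0]]] := IH v.
  by exists u', v'; rewrite /= -eu -ev.
Qed.

(** For each [k <= size s] there is exactly one prefix of that length, [take k s], so the prefixes
    can be indexed by their lengths. *)
Lemma big_prefix_size (V : nmodType) (T : eqType) (S : seq (seq T)) (s : seq T)
    (F : nat -> V) :
  uniq S -> (forall p, prefix p s -> p \in S) ->
  \sum_(p <- S | prefix p s) F (size p) = \sum_(0 <= k < (size s).+1) F k.
Proof.
move=> uS memS; rewrite -big_filter.
have -> : \sum_(0 <= k < (size s).+1) F k =
    \sum_(p <- [seq take k s | k <- iota 0 (size s).+1]) F (size p).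
  rewrite big_map /index_iota subn0 big_seq [RHS]big_seq.
  apply: eq_bigr => k; rewrite mem_iota add0n ltnS => /andP[_ ks].
  by rewrite size_takel.
apply: perm_big; apply: uniq_perm; first exact: filter_uniq.
  rewrite map_inj_in_uniq ?iota_uniq // => i j.
  rewrite !mem_iota !add0n !ltnS => /andP[_ is_] /andP[_ js] /(congr1 size).
  by rewrite !size_takel.
move=> p; rewrite mem_filter; apply/andP/mapP.
  move=> [ps _]; exists (size p); last by move: ps; rewrite prefixE => /eqP.
  by rewrite mem_iota add0n ltnS size_prefix.
by move=> [k _ ->]; split; [|apply: memS]; exact: prefix_take.
Qed.

Lemma letter_invK (N : nat) : involutive (@letter_inv N).
Proof. by case=> i b; rewrite /letter_inv /= negbK. Qed.

Lemma letter_val_inv (G : groupType) (N : nat) (a : 'I_N -> G) (l : letter N) :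
  letter_val a (letter_inv l) = ((letter_val a l)^-1)%g.
Proof. by case: l => i [] //=; rewrite /letter_val /= invgK. Qed.

Lemma word_val_catrev_inv (G : groupType) (N : nat) (a : 'I_N -> G)
    (u v : seq (letter N)) :
  word_val a (catrev (map (@letter_inv N) u) v) =
  ((word_val a u)^-1 * word_val a v)%g.
Proof.
rewrite /word_val; elim: u v => [|x u IH] v /=.
  by rewrite big_nil invg1 mul1g.
by rewrite IH !big_cons letter_val_inv invgM mulgA.
Qed.

(** This word spells the inverse of [u] followed by [v]. Letters of [u] cross over one at a time:
    the empty [lcp] prevents a cancellation at the junction, and since [u] is reduced its next
    letter differs from the one just placed, which keeps the [lcp] empty. *)
Lemma reduced_catrev_inv (N : nat) (u v : seq (letter N)) :
  reduced u -> reduced v -> lcp u v = [::] ->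
  reduced (catrev (map (@letter_inv N) u) v).
Proof.
elim: u v => [|x u IH] v //= ru rv uv0; apply: IH.
- by case: u ru {uv0} => //= y u /andP[].
- case: v rv uv0 => //= y v -> ; rewrite andbT letter_invK.
  by rewrite eq_sym; case: eqP.
- by case: u ru {uv0} => //= y u /andP[/negbTE->].
Qed.

Section WordLength.
Variables (G : groupType) (N : nat) (a : 'I_N -> G) (aF : free_generators a).

Lemma reduced_wordP (g : G) :
  reduced (reduced_word aF g) /\ word_val a (reduced_word aF g) = g.
Proof. by rewrite /reduced_word; case: cid => w []. Qed.

Lemma reduced_word_val (w : seq (letter N)) :
  reduced w -> reduced_word aF (word_val a w) = w.
Proof.
move=> rw; rewrite /reduced_word; case: cid => u [_ /=]; exact.
Qed.

Lemma reduced_word_inj : injective (reduced_word aF).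
Proof.
move=> g h e; rewrite -(reduced_wordP g).2 -(reduced_wordP h).2.
by rewrite e.
Qed.

(** The common prefix is added on the left because subtraction in [nat] truncates. *)
Lemma word_lengthVM (g h : G) :
  (word_length aF (h^-1 * g)%g +
     (size (lcp (reduced_word aF g) (reduced_word aF h))).*2 =
   size (reduced_word aF g) + size (reduced_word aF h))%N.
Proof.
have [rg vg] := reduced_wordP g; have [rh vh] := reduced_wordP h.
set u := reduced_word aF g in rg vg *; set v := reduced_word aF h in rh vh *.
have [u' [v' [eu ev e0]]] := lcp_decomp _ u v.
set p := lcp u v in eu ev *.
have ru' : reduced u' by move: rg; rewrite eu => /cat_sorted2[].
have rv' : reduced v' by move: rh; rewrite ev => /cat_sorted2[].
have -> : (h^-1 * g)%g = word_val a (catrev (map (@letter_inv N) v') u').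
  rewrite word_val_catrev_inv -vg -vh eu ev /word_val !big_cat /=.
  by rewrite invgM -mulgA mulKg.
rewrite /word_length reduced_word_val; last first.
  by apply: reduced_catrev_inv; rewrite // lcpC.
rewrite catrevE size_cat size_rev size_map eu ev !size_cat -addnn.
by rewrite [RHS]addnACA addnC [(size v' + _)%N]addnC.
Qed.

End WordLength.

Section PrefixKernel.
Variables (R : realFieldType) (r : R).
Hypotheses (r_gt0 : 0 < r) (r_lt1 : r < 1).

(** Increments of [k |-> r ^- k.*2], started at its value 1 at 0; they are positive because
    [r < 1]. *)
Definition prefix_weight (k : nat) : R :=
  if k is m.+1 then r ^- (m.+1).*2 - r ^- m.*2 else 1.

Lemma prefix_weight_gt0 (k : nat) : 0 < prefix_weight k.
Proof.
case: k => [|k] /=; first exact: ltr01.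
rewrite subr_gt0 ltf_pV2 ?posrE ?exprn_gt0 //.
by rewrite ltr_iXn2l // ltn_double.
Qed.

Lemma sum_prefix_weight (m : nat) :
  \sum_(0 <= k < m.+1) prefix_weight k = r ^- m.*2.
Proof.
elim: m => [|m IH]; first by rewrite big_nat1 /= expr0 invr1.
by rewrite big_nat_recr //= IH addrC subrK.
Qed.

Definition prefix_coord {T : eqType} (u s : seq T) : R :=
  if prefix s u then r ^+ size u else 0.

(** Words of [S] other than common prefixes contribute 0, so a single list [S] can serve all pairs
    of points. *)
Lemma prefix_kernelE (T : eqType) (S : seq (seq T)) (u v : seq T) (d : nat) :
  uniq S -> (forall s, prefix s u -> s \in S) ->
  (d + (size (lcp u v)).*2 = size u + size v)%N ->
  r ^+ d =
  \sum_(s <- S) prefix_weight (size s) * prefix_coord u s * prefix_coord v s.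
Proof.
move=> uS memS ed.
transitivity (\sum_(s <- S | prefix s (lcp u v))
                prefix_weight (size s) * r ^+ (size u + size v)).
  rewrite -mulr_suml big_prefix_size //; last first.
    by move=> s; rewrite prefix_lcp => /andP[/memS].
  rewrite sum_prefix_weight -ed exprD mulrCA mulVf ?mulr1 //.
  by rewrite expf_neq0 // gt_eqF.
rewrite big_mkcond; apply: eq_bigr => s _.
rewrite prefix_lcp /prefix_coord.
by case: (prefix s u); case: (prefix s v);
  rewrite /= ?mulr0 ?mul0r // -mulrA -exprD.
Qed.

(** A prefix of [u] at least as long as [u] is [u] itself. *)
Lemma prefix_coord_maximal (T : eqType) (u v : seq T) :
  (size u <= size v)%N -> u != v -> prefix_coord u v = 0.
Proof.
move=> uv nuv; rewrite /prefix_coord prefixE take_oversize //.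
by rewrite (negbTE nuv).
Qed.

End PrefixKernel.

(** For fixed [s] the matrix [f i s * f j s] has rank one and is real, so its form is [z * z^*] with
    [z] the sum of the [c 0 i * f i s]. *)
Lemma quadratic_form_diag (R : rcfType) (n : nat) (I : Type) (S : seq I)
    (w : I -> R) (f : 'I_n -> I -> R) (c : 'rV[R[i]]_n) :
  \sum_(i < n) \sum_(j < n) c 0 i * (c 0 j)^* *
     (\sum_(s <- S) w s * f i s * f j s)%:C%C =
  \sum_(s <- S) (w s)%:C%C * `|\sum_(i < n) c 0 i * (f i s)%:C%C| ^+ 2.
Proof.
under eq_bigr => i _.
  under eq_bigr => j _ do rewrite rmorph_sum mulr_sumr.
  rewrite exchange_big; over.
rewrite exchange_big; apply: eq_bigr => s _ /=.
rewrite normCK rmorph_sum big_distrlr mulr_sumr; apply: eq_bigr => i _.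
rewrite mulr_sumr; apply: eq_bigr => j _ /=.
have fR : ((f j s)%:C%C : R[i])^* = (f j s)%:C%C.
  by apply: conj_Creal; apply/complex_realP; exists (f j s).
rewrite !rmorphM /= fR.
rewrite [in RHS]mulrACA -[X in _ * X = _]mulrA; exact: mulrCA.
Qed.

Theorem mainTheorem5 (R : realType) (G : groupType) (N : nat) (a : 'I_N -> G)
    (aF : free_generators a) (t : R) (t_gt0 : 0 < t) :
  strictly_positive_definite
    (fun g h : G =>
       (expR (- t * (word_length aF (h^-1 * g)%g)%:R))%:C%C).
Proof.
pose r := expR (- t).
have r_gt0 : 0 < r by exact: expR_gt0.
have r_lt1 : r < 1 by rewrite /r expR_lt1 oppr_lt0.
pose W := reduced_word aF.
pose wt (s : seq (letter N)) := prefix_weight R r (size s).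
have wt_gt0 s : 0 < (wt s)%:C%C :> R[i].
  by rewrite ltcR; apply: prefix_weight_gt0.
have form n (x : 'I_n -> G) (c : 'rV[R[i]]_n) :
  exists2 S, forall i, W (x i) \in S &
  \sum_(i < n) \sum_(j < n) c 0 i * (c 0 j)^* *
    (expR (- t * (word_length aF ((x j)^-1 * x i)%g)%:R))%:C%C =
  \sum_(s <- S) (wt s)%:C%C *
    `|\sum_(i < n) c 0 i * (prefix_coord R r (W (x i)) s)%:C%C| ^+ 2.
  (* All prefixes of all the words [W (x i)]; [undup] makes each of them count once. *)
  pose S := undup (flatten
    [seq [seq take k (W (x i)) | k <- iota 0 (size (W (x i))).+1]
      | i <- enum 'I_n]).
  have memS i s : prefix s (W (x i)) -> s \in S.
    move=> ps; rewrite mem_undup; apply/flatten_mapP; exists i.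
      by rewrite mem_enum.
    apply/mapP; exists (size s); last by move: ps; rewrite prefixE => /eqP.
    by rewrite mem_iota add0n ltnS size_prefix.
  exists S; first by move=> i; apply: (memS i); exact: prefix_refl.
  rewrite -quadratic_form_diag; apply: eq_bigr => i _; apply: eq_bigr => j _.
  rewrite -(prefix_kernelE _ _ r_gt0 _ _ _ _
             (word_length aF ((x j)^-1 * x i)%g)) ?undup_uniq //; last first.
  - exact: word_lengthVM.
  - exact: memS.
  by rewrite expRM_natr.
split; [split|].
- move=> g h; rewrite conj_Creal; last by apply/complex_realP; eexists.
  (* The right side of [word_lengthVM] and the size of the [lcp] are both symmetric in the two
     elements. *)
  have e : word_length aF (g^-1 * h)%g = word_length aF (h^-1 * g)%g.
    apply/eqP; rewrite -(eqn_add2r (size (lcp (W g) (W h))).*2).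
    by rewrite {1}lcpC !word_lengthVM addnC.
  by rewrite e.
- move=> n x c _; have [S _ ->] := form n x c.
  by apply: sumr_ge0 => s _; rewrite mulr_ge0 ?exprn_ge0 // ltW.
- move=> n x c _ x_inj c_neq0; have [S memS ->] := form n x c.
  have [i0 ci0] : exists i, c 0 i != 0 by apply/rV0Pn.
  case: (@arg_maxnP _ i0 (fun i => c 0 i != 0) (fun i => size (W (x i))) ci0)
    => i ci imax.
  rewrite (big_rem (W (x i))) //=; apply: ltr_pwDl; last first.
    by apply: sumr_ge0 => s _; rewrite mulr_ge0 ?exprn_ge0 // ltW.
  rewrite mulr_gt0 // exprn_gt0 // normr_gt0 (bigD1 i) //= big1 ?addr0.
    rewrite mulf_neq0 // /prefix_coord prefix_refl.
    by rewrite gt_eqF // ltcR exprn_gt0.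
  (* If [c 0 j] is nonzero, then [W (x j)] is no longer than [W (x i)] by the choice of [i], and
     differs from it by injectivity; hence [W (x i)] is not a prefix of it. *)
  move=> j ji; have [->|cj] := eqVneq (c 0 j) 0; first by rewrite mul0r.
  rewrite prefix_coord_maximal ?mulr0 //; first exact: imax.
  by apply: contra ji => /eqP/reduced_word_inj/x_inj->.
Qed.
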